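(* For any tree $T$ with at least three vertices, $\kappa(T)\ge 2$.
   Context: $d_T$ is the shortest-path distance. For $S\subseteq V(T)$ and $x\in V(T)$, $m(x|S)$ is the multiset $\{\!\{d_T(x,s): s\in S\}\!\}$. A nonempty set $S\subsetneq V(T)$ is a $k$-multiset antiresolving set ($k$-MARS) if $k$ equals the minimum size of an equivalence class of the relation on $V(T)\setminus S$ given by $x\sim y \iff m(x|S)=m(y|S)$. $\kappa(T)$ denotes the largest integer $k$ such that $T$ contains a $k$-MARS. *)

(* Defs.v *)
From mathcomp Require Import all_boot.
From mathcomp Require Import finmap multiset.

Set Implicit Arguments.
Unset Strict Implicit.
Unset Printing Implicit Defensive.

Local Open Scope mset_scope.
Local Open Scope nat_scope.

Section Graph.

Variables (V : finType) (e : rel V).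

Definition simple_graph : Prop := symmetric e /\ irreflexive e.

Definition connected : Prop := forall x y : V, connect e x y.

(* [ucycle e c] also holds for the empty sequence and for an edge traversed
   back and forth, hence the bound on the size. *)
Definition acyclic : Prop := forall c : seq V, ucycle e c -> size c < 3.

Definition is_tree : Prop := [/\ simple_graph, connected & acyclic].

Definition walk (n : nat) (x y : V) : bool :=
  [exists p : n.-tuple V, path e x p && (last x p == y)].

(* The least length of a walk from [x] to [y]; the lengths below #|V| suffice,
   and the value is #|V| if [y] is not reachable from [x]. *)
Definition dist (x y : V) : nat := find (fun n => walk n x y) (iota 0 #|V|).

Definition mrep (S : {set V}) (x : V) : {mset nat} :=
  seq_mset [seq dist x s | s <- enum S].

Definition mclasses (S : {set V}) : {set {set V}} :=
  equivalence_partition (fun x y => mrep S x == mrep S y) (~: S).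

Definition is_kMARS (k : nat) (S : {set V}) : bool :=
  [&& S != set0, S \proper [set: V],
      [exists C in mclasses S, #|C| == k] &
      [forall C in mclasses S, k <= #|C|]].

(* A class has at most #|V| elements, so bounding [k] loses nothing. *)
Definition kappa : nat :=
  \max_(k < #|V|.+1 | [exists S : {set V}, is_kMARS k S]) k.

Lemma walkP n x y :
  reflect (exists p : seq V, [/\ size p = n, path e x p & last x p = y])
          (walk n x y).
Proof.
apply: (iffP existsP) => [[p /andP[xp /eqP yp]]|[p [sp xp yp]]].
  by exists p; rewrite size_tuple.
by exists (tcast sp (in_tuple p)); rewrite val_tcast /= xp yp eqxx.
Qed.

Lemma connect_walk x y : connect e x y -> exists2 n, n < #|V| & walk n x y.
Proof.
case/connectP => p xp ->; case: (shortenP xp) => q xq uq _.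
exists (size q); last by apply/walkP; exists q.
by have /card_uniqP/= <- := uq; apply: max_card.
Qed.

Lemma walk_dist x y : connect e x y -> walk (dist x y) x y.
Proof.
case/connect_walk => n ltn xy.
have h : has (fun n => walk n x y) (iota 0 #|V|).
  by apply/hasP; exists n => //; rewrite mem_iota.
have := nth_find 0 h; rewrite nth_iota //.
by move: h; rewrite has_find size_iota.
Qed.

Lemma dist_min x y n : walk n x y -> dist x y <= n.
Proof.
move=> xy; rewrite leqNgt; apply/negP => lt_n.
have ltV : n < #|V|.
  by apply: leq_trans lt_n _; rewrite -[X in _ <= X](size_iota 0) find_size.
by have := before_find 0 lt_n; rewrite nth_iota // add0n xy.
Qed.

Lemma mem_mclasses (S C : {set V}) :
  reflect (exists2 x, x \notin S &
             C = [set y in ~: S | mrep S x == mrep S y])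
          (C \in mclasses S).
Proof.
apply: (iffP imsetP) => -[x xS ->]; exists x => //; first by rewrite inE in xS.
by rewrite inE.
Qed.

Lemma kMARS_le_kappa k S : is_kMARS k S -> k <= kappa.
Proof.
move=> kS; have kV : k < #|V|.+1.
  case/and4P: kS => _ _ /exists_inP[C _ /eqP <-] _.
  by rewrite ltnS max_card.
apply: (bigmax_sup (Ordinal kV)) => //.
by apply/existsP; exists S.
Qed.

Lemma kMARS_exists (S : {set V}) :
  S != set0 -> S \proper [set: V] -> exists k, is_kMARS k S.
Proof.
move=> S0 ST; case/properP: (ST) => _ [x _ xS].
pose C0 := [set y in ~: S | mrep S x == mrep S y].
have C0S : C0 \in mclasses S by apply/mem_mclasses; exists x.
case: (arg_minnP (fun C : {set V} => #|C|) C0S) => C CS Cmin.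
exists #|C|; apply/and4P; split => //.
  by apply/exists_inP; exists C.
by apply/forall_inP.
Qed.

Lemma kappa_kMARS : 1 < #|V| -> exists S, is_kMARS kappa S.
Proof.
move=> V1; have /card_gt0P[x _] : 0 < #|V| by apply: ltnW.
have [||k kS] := @kMARS_exists [set x].
- by apply/set0Pn; exists x; rewrite set11.
- by rewrite properEcard subsetT cards1 cardsT.
have kV : k < #|V|.+1.
  case/and4P: kS => _ _ /exists_inP[C _ /eqP <-] _.
  by rewrite ltnS max_card.
pose P (i : 'I_#|V|.+1) := [exists S : {set V}, is_kMARS i S].
have Pk : P (Ordinal kV) by apply/existsP; exists [set x].
rewrite /kappa -/P (@bigmax_eq_arg _ (Ordinal kV) P) //.
by case: arg_maxnP => // i /existsP.
Qed.

End Graph.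

(* Main.v *)
Require Import Defs.
From mathcomp Require Import all_boot.
From mathcomp Require Import finmap multiset zify.

Set Implicit Arguments.
Unset Strict Implicit.
Unset Printing Implicit Defensive.

(** Let [c] be a vertex of minimal eccentricity [r]. If every distance level
    [1..r] around [c] has at least two vertices, then [{c}] works. A level [k]
    reduced to one vertex [w] is crossed by every geodesic from [c] to a
    vertex at distance [>= k]; moving from [c] to the neighbour [c'] of [c] on
    a geodesic to [w] would decrease the eccentricity unless [k = r]. So [w] is
    the only vertex at distance [r] from [c], and [c'] also has eccentricity
    [r]. If [{c'}] does not work either, then [c'] has a unique vertex [w'] at
    distance [r], and [{c, c'}] works: as trees are bipartite, the multiset of
    [x] is [{k, k+1}] with [k < r], and that multiset is also attained on
    the geodesic from [c] to [w] and on the geodesic from [c'] to [w']. *)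

Section Distance.

Variables (V : finType) (e : rel V).
Hypotheses (sym_e : symmetric e) (conn_e : connected e).

Lemma dist_path_le x p : path e x p -> dist e x (last x p) <= size p.
Proof. by move=> xp; apply/dist_min/walkP; exists p. Qed.

Lemma geodesic_path x y :
  exists p, [/\ path e x p, last x p = y, size p = dist e x y & uniq (x :: p)].
Proof.
have /walkP[p [sp xp yp]] := walk_dist (conn_e x y).
case: (shortenP xp) yp => q xq uq qp yq.
exists q; split=> //; apply/eqP; rewrite eqn_leq -{2}yq dist_path_le // andbT.
by rewrite -sp; apply: uniq_leq_size => //; case/andP: uq.
Qed.

Lemma distxx x : dist e x x = 0.
Proof. by apply/eqP; rewrite -leqn0 (@dist_path_le x [::]). Qed.

Lemma dist_eq0 x y : (dist e x y == 0) = (x == y).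
Proof.
apply/eqP/eqP => [xy|->]; last exact: distxx.
by have [[|z p] [_ /= py]] := geodesic_path x y; rewrite xy.
Qed.

Lemma dist_triangle y x z : dist e x z <= dist e x y + dist e y z.
Proof.
have [p [xp py <- _]] := geodesic_path x y.
have [q [yq <- <- _]] := geodesic_path y z.
rewrite -size_cat -{1}py -last_cat; apply: dist_path_le.
by rewrite cat_path xp py.
Qed.

Lemma dist_sym x y : dist e x y = dist e y x.
Proof.
suff le a b : dist e a b <= dist e b a by apply/eqP; rewrite eqn_leq !le.
have [p [bp <- <- _]] := geodesic_path b a.
rewrite -(size_belast b p) -size_rev.
have lb : last (last b p) (rev (belast b p)) = b.
  by case: p {bp} => //= z p; rewrite rev_cons last_rcons.
have := @dist_path_le (last b p) (rev (belast b p)); rewrite lb; apply.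
by rewrite rev_path (eq_path (e' := e)).
Qed.

Lemma geodesic_mem x p z :
    path e x p -> size p = dist e x (last x p) -> z \in x :: p ->
  dist e x z + dist e z (last x p) = dist e x (last x p).
Proof.
move=> xp sp zp; case/splitPl: zp xp sp => p1 p2 <-.
rewrite cat_path last_cat size_cat => /andP[/dist_path_le l1 /dist_path_le l2] sp.
by apply/eqP; rewrite eqn_leq dist_triangle andbT -sp leq_add.
Qed.

Lemma geodesic_point x y k : k <= dist e x y ->
  exists2 z, dist e x z = k & k + dist e z y = dist e x y.
Proof.
have [p [xp yp sp _]] := geodesic_path x y; rewrite -sp => kp.
(* Its distances to [x] and [y] are at most the lengths of the two pieces of [p], which add up to
   [dist e x y]; the triangle inequality makes both bounds equalities. *)
exists (last x (take k p)).
all: move: xp yp; rewrite -{1 2}(cat_take_drop k p) cat_path last_cat.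
all: move=> /andP[/dist_path_le l1 /dist_path_le l2] yp.
all: have := dist_triangle (last x (take k p)) x y.
all: by move: l1 l2; rewrite yp size_drop size_takel //; lia.
Qed.

End Distance.

Section Tree.

Variables (V : finType) (e : rel V).
Hypothesis treeT : is_tree e.

(* The vertex [y] equidistant from [c] and [c'] and closest to them closes an
   odd cycle with the geodesics to [c] and [c'], which meet only in [y]. *)
Lemma tree_dist_neq c c' x : e c c' -> dist e c x != dist e c' x.
Proof.
have [[sym_e irr_e] conn_e acyc_e] := treeT.
move=> cc'; apply/negP=> eqx.
case: (@arg_minnP _ x (fun y => dist e c y == dist e c' y) (dist e c) eqx).
move=> y /eqP eqy miny.
have [p [cp py sp up]] := geodesic_path conn_e c y.
have [q [cq qy sq uq]] := geodesic_path conn_e c' y.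
have lq : last y (rev (belast c' q)) = c'.
  by case: (q) qy => //= z s _; rewrite rev_cons last_rcons.
(* Out along [p] to [y], back along [q] to [c'], closed by the edge to [c]; [belast] prevents [y]
   from occurring twice. *)
have /acyc_e : ucycle e ((c :: p) ++ rev (belast c' q)).
  apply/andP; split.
    rewrite /= rcons_cat cat_path cp py /= rcons_path lq -{1}qy rev_path.
    by rewrite (eq_path (e' := e)) // cq sym_e.
  move: uq; rewrite lastI qy rcons_uniq => /andP[yq uq].
  rewrite cat_uniq up rev_uniq uq andbT /=; apply/hasPn=> z.
  rewrite mem_rev => zq; apply/negP=> zp.
  (* A shared vertex [z] other than [y] would also be equidistant from [c] and [c'], yet closer than
     [y]. *)
  have zy : dist e z y != 0.
    by rewrite dist_eq0 //; apply: contraNneq yq => <-.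
  have /= := geodesic_mem conn_e cp _ zp; rewrite py => /(_ sp) dp.
  have := geodesic_mem (z := z) conn_e cq; rewrite lastI qy mem_rcons inE zq orbT.
  move=> /(_ sq isT) dq.
  by have := miny z; lia.
(* The cycle has [2 * dist e c y + 1] vertices; fewer than 3 forces [c = y = c'], against
   irreflexivity. *)
rewrite size_cat size_rev size_belast /= sp sq -eqy => cy.
have /eqP : dist e c y == 0 by lia.
move=> c0; have /eqP E : c == y by rewrite -(dist_eq0 conn_e) c0.
have /eqP E' : c' == y by rewrite -(dist_eq0 conn_e) -eqy c0.
by move: cc'; rewrite E E' irr_e.
Qed.

End Tree.

Section Kappa.

Variables (V : finType) (e : rel V).

(** A smallest class contains some [x] together with its mate [y], so the [k] for which [S] is a
    [k]-MARS is at least 2. *)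
Lemma kappa_ge2 (S : {set V}) : S != set0 -> S \proper [set: V] ->
    (forall x, x \notin S ->
       exists2 y, y \notin S & y != x /\ mrep e S x = mrep e S y) ->
  2 <= kappa e.
Proof.
move=> S0 ST mate; have [k kS] := kMARS_exists e S0 ST.
apply: leq_trans (kMARS_le_kappa kS).
case/and4P: kS => _ _ /exists_inP[C /mem_mclasses[x xS ->] /eqP <-] _.
have [y yS [yx exy]] := mate x xS.
have <- : #|[set y; x]| = 2 by rewrite cards2 yx.
by apply/subset_leq_card/subsetP=> z; rewrite !inE => /orP[]/eqP->;
   rewrite ?xS ?yS ?exy eqxx.
Qed.

Lemma mrep_set1 c x : mrep e [set c] x = seq_mset [:: dist e x c].
Proof. by rewrite /mrep enum_set1. Qed.

Lemma mrep_set2 c c' x : c != c' ->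
  mrep e [set c; c'] x = seq_mset [:: dist e x c; dist e x c'].
Proof.
move=> cc'; apply/eq_seq_msetP.
have /(perm_map (dist e x))// : perm_eq (enum [set c; c']) [:: c; c'].
apply: uniq_perm; rewrite ?enum_uniq //= ?inE ?cc' // => z.
by rewrite mem_enum !inE.
Qed.

Hypothesis (conn_e : connected e) (sym_e : symmetric e).

(** The classes of [[set c]] are the nonzero distance levels around [c]. *)
Lemma kappa_ge2_levels c : 1 < #|V| ->
    (forall x, x != c -> exists2 y, y != x & dist e c y = dist e c x) ->
  2 <= kappa e.
Proof.
move=> V1 lev; apply: (@kappa_ge2 [set c]).
- by apply/set0Pn; exists c; rewrite set11.
- by rewrite properEcard subsetT cards1 cardsT.
move=> x; rewrite inE => xc; have [y yx dy] := lev x xc.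
exists y; last by split=> //; rewrite !mrep_set1 !(dist_sym sym_e conn_e _ c) dy.
by rewrite inE eq_sym -(dist_eq0 conn_e) dy (dist_eq0 conn_e) eq_sym.
Qed.

(* The last two hypotheses say that [c] is a center and [r] the radius. *)
Lemma kappa_ge2_or_far_unique c r : 1 < #|V| ->
    (forall x, dist e c x <= r) ->
    (forall c', exists x, r <= dist e c' x) ->
  2 <= kappa e \/
  exists w, [/\ 0 < r, dist e c w = r & forall y, dist e c y = r -> y = w].
Proof.
move=> V1 ecc rad.
have [/existsP[w /andP[wc /forallP uw]]|no] := boolP
  [exists w, (w != c) && [forall y, (dist e c y == dist e c w) ==> (y == w)]].
  have {}uw y : dist e c y = dist e c w -> y = w.
    by move=> E; apply/eqP/(implyP (uw y)); rewrite E.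
  have d0 : 0 < dist e c w by rewrite lt0n dist_eq0 // eq_sym.
  suff E : dist e c w = r by right; exists w; rewrite -E.
  apply/eqP; rewrite eqn_leq ecc /= leqNgt; apply/negP=> lt.
  have [c' d1 d1w] := geodesic_point conn_e d0.
  have [x rx] := rad c'.
  have c'c : dist e c' c = 1 by rewrite dist_sym.
  (* Both cases give [dist e c' x < r]. From the level of [w] on, a geodesic from [c] passes through
     [w], to which [c'] is one step closer; below that level [dist e c x <= r - 2], and [c'] adds at
     most 1. *)
  have [lx|gx] := leqP (dist e c w) (dist e c x).
    have [w' /uw -> dwx] := geodesic_point conn_e lx.
    by have := dist_triangle conn_e w c' x; have := ecc x; lia.
  by have := dist_triangle conn_e c c' x; lia.
left; apply: (@kappa_ge2_levels c V1) => x xc; move: no; rewrite negb_exists.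
move=> /forallP/(_ x); rewrite xc /= negb_forall => /existsP[y].
by rewrite negb_imply => /andP[/eqP dy yx]; exists y.
Qed.

End Kappa.

Lemma exists_center (V : finType) (e : rel V) (c0 : V) :
  exists c r, (forall x, dist e c x <= r) /\
              (forall c', exists x, r <= dist e c' x).
Proof.
pose ecc c := \max_x dist e c x.
case: (@arg_minnP _ c0 predT ecc isT) => c _ minc.
exists c, (ecc c); split=> [x|c']; first exact: leq_bigmax.
have V0 : 0 < #|V| by apply/card_gt0P; exists c0.
have [x ex] := eq_bigmax (dist e c') V0.
by exists x; rewrite -ex minc.
Qed.

Theorem theorem6 (V : finType) (e : rel V) (treeT : is_tree e)
  (card_V : 3 <= #|V|) : 2 <= kappa e.
Proof.
have [[sym_e irr_e] conn_e _] := treeT.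
have V1 : 1 < #|V| by apply: ltnW.
have /card_gt0P[c0 _] := ltnW V1.
have [c [r [ecc rad]]] := exists_center e c0.
have [//|[w [r0 dw uw]]] := kappa_ge2_or_far_unique conn_e sym_e V1 ecc rad.
have [c' d1 d1w] : exists2 z, dist e c z = 1 & 1 + dist e z w = dist e c w.
  by apply: geodesic_point => //; rewrite dw.
have cc' : e c c'.
  by have [[|a [|b p]] [/= + + + _]] := geodesic_path conn_e c c';
     rewrite ?d1 // andbT => + <-.
have nc : c != c' by rewrite -(dist_eq0 conn_e) d1.
(* Together with [d1] and [d1'], this says that the distances from [c] and [c'] to [x] differ by
   exactly 1. *)
have adj x := And3 (tree_dist_neq treeT x cc') (dist_triangle conn_e c c' x)
                   (dist_triangle conn_e c' c x).
have d1' : dist e c' c = 1 by rewrite dist_sym.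
have ecc' x : dist e c' x <= r.
  have [xr|xr] := eqVneq (dist e c x) r; first by rewrite (uw _ xr); lia.
  by have := adj x; rewrite d1' => -[_ + _]; have := ecc x; lia.
have [//|[w' [_ dw' _]]] := kappa_ge2_or_far_unique conn_e sym_e V1 ecc' rad.
have dcw' : 1 + dist e c w' = r.
  by have := adj w'; rewrite d1 d1' => -[]; have := ecc w'; lia.
apply: (@kappa_ge2 _ _ [set c; c']).
- by apply/set0Pn; exists c; rewrite !inE eqxx.
- by rewrite properEcard subsetT cards2 cardsT nc.
have mrepE x : mrep e [set c; c'] x = seq_mset [:: dist e c x; dist e c' x].
  by rewrite mrep_set2 // !(dist_sym sym_e conn_e x).
(* The order is immaterial: a vertex [y] whose two distances are those of [x] swapped is a mate of
   [x]. *)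
have mrepC x : mrep e [set c; c'] x = seq_mset [:: dist e c' x; dist e c x].
  rewrite mrepE; apply/eq_seq_msetP.
  by rewrite (perm_catC [:: dist e c x]).
have notS x : (x \notin [set c; c']) = (0 < dist e c x) && (0 < dist e c' x).
  by rewrite !inE negb_or !lt0n !dist_eq0 // ![x == _]eq_sym.
move=> x; rewrite notS => /andP[x0 x0'].
have := adj x; rewrite d1 d1' => -[xneq xle xle'].
have ex := ecc x; have ex' := ecc' x.
have [lt|ge] := ltnP (dist e c x) (dist e c' x).
  (* Here [dist e c x <= r - 1 = dist e c' w], so [y] exists; were [dist e c y] not larger than
     [dist e c' y], then [w] would be closer than [r] to [c]. *)
  have [y dy dyw] : exists2 y, dist e c' y = dist e c x &
      dist e c x + dist e y w = dist e c' w.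
    by apply: geodesic_point => //; lia.
  have dcy : dist e c y = dist e c' x.
    have := adj y; have := dist_triangle conn_e y c w; rewrite d1 d1'.
    by move=> ? []; lia.
  exists y; first by rewrite notS dy dcy x0 x0'.
  by split; [apply: contraTneq lt => E; rewrite -{1}dcy E; lia
            | rewrite mrepC mrepE dy dcy].
(* The mirror case, with [w'] in place of [w] and [dist e c w' = r - 1]. *)
have [y dy dyw] : exists2 y, dist e c y = dist e c' x &
    dist e c' x + dist e y w' = dist e c w'.
  by apply: geodesic_point => //; lia.
have dcy : dist e c' y = dist e c x.
  have := adj y; have := dist_triangle conn_e y c' w'; rewrite d1 d1'.
  by move=> ? []; lia.
exists y; first by rewrite notS dy dcy x0 x0'.
by split; [apply: contraNneq xneq => E; rewrite -{1}dcy E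
          | rewrite mrepC mrepE dy dcy].
Qed.
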